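(* Let $n\in\mathbb{N}$, $\gamma>0$, $\lambda>0$ and let $N_{r,\gamma,\mu_n}$ be a random variable having the generalized negative binomial (GNB) distribution with parameters $r>0$, $\gamma>0$ and $\mu_n=\lambda/n^{\gamma}$. Let $X_1,X_2,\ldots$ be independent identically distributed random variables with common distribution function $F(x)$, where for each $n$ the random variable $N_{r,\gamma,\mu_n}$ is independent of the sequence $X_1,X_2,\ldots$. Assume that $\mathrm{rext}(F)=\sup\{x: F(x)<1\}=\infty$ and that there exists a number $\alpha>0$ such that for any $x>0$ $$\lim_{y\to\infty}\frac{1-F(xy)}{1-F(y)}=x^{-\alpha}.$$ Then $$\lim_{n\to\infty}\sup_{x\ge 0}\left|\mathbb{P}\left(\frac{\max\{X_1,\ldots,X_{N_{r,\gamma,\mu_n}}\}}{F^{-1}(1-\frac1n)}<x\right)-F(x;r,\alpha,\gamma,\lambda)\right|=0,$$ where $F(x;r,\alpha,\gamma,\lambda)=\mathbb{P}(M_{r,\alpha,\gamma,\lambda}<x)$, $x\in\mathbb{R}$, and $$M_{r,\alpha,\gamma,\lambda}\stackrel{d}{=}\frac{\overline{G}_{r,\alpha\gamma,\lambda}}{W_\alpha}\stackrel{d}{=}\left(\frac{\overline{G}_{r,\gamma,\lambda}}{W_1}\right)^{1/\alpha}\stackrel{d}{=}\lambda^{-1/(\alpha\gamma)}\left(\frac{G_{r,1}}{W_{\gamma}}\right)^{1/(\alpha\gamma)},$$ and in each term the involved random variables are independent.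
   Context: The symbol $\stackrel{d}{=}$ denotes equality in distribution. For $r>0$, $\gamma\neq 0$ real, $\mu>0$, $\overline{G}_{r,\gamma,\mu}$ denotes a random variable with the generalized gamma distribution, i.e. with density $g^*(x;r,\gamma,\mu)=\frac{|\gamma|\mu^r}{\Gamma(r)}x^{\gamma r-1}e^{-\mu x^\gamma}$, $x\ge 0$. $G_{r,\mu}\stackrel{d}{=}\overline{G}_{r,1,\mu}$ denotes a gamma random variable with shape parameter $r$ and scale parameter $\mu$ (density $\frac{\mu^r}{\Gamma(r)}x^{r-1}e^{-\mu x}$). For $\gamma>0$, $W_\gamma\stackrel{d}{=}\overline{G}_{1,\gamma,1}$ denotes a Weibull random variable (density $\gamma x^{\gamma-1}e^{-x^\gamma}$). A random variable $N_{r,\gamma,\mu}$ has the GNB distribution with parameters $r,\gamma,\mu$ if $\mathbb{P}(N_{r,\gamma,\mu}=k)=\frac1{k!}\int_0^\infty e^{-z}z^k g^*(z;r,\gamma,\mu)\,dz$, $k=0,1,2,\ldots$. $F^{-1}$ denotes the (generalized) inverse of $F$. On the event $N_{r,\gamma,\mu_n}=0$, whose probability tends to $0$, the maximum is taken to be $0$.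
   Formalization: In the last representation of M, W_γ is replaced by W_{1/γ}: as printed, the third equality in distribution is false unless γ=1 (e.g. r=α=λ=1, γ=2 gives tails of order x^{-1} versus x^{-4}). *)

(* Defs.v *)
(* MathComp-Analysis *)
From mathcomp Require Export all_boot all_order all_algebra.
From mathcomp Require Export all_classical all_reals all_analysis.

Set Implicit Arguments.
Unset Strict Implicit.
Unset Printing Implicit Defensive.

Export Order.TTheory GRing.Theory Num.Theory.
Export numFieldNormedType.Exports.

Local Open Scope classical_set_scope.
Local Open Scope ring_scope.

Section distribution_functions.
Context {R : realType}.

(* Left-continuous convention: P(X < x), whereas the library's [cdf] is
   P(X <= x). *)
Definition dfun d (T : measurableType d) (P : probability T R)
  (X : T -> R) (x : R) : R := fine (P [set w | X w < x]).

Definition rext (F : R -> R) : \bar R :=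
  ereal_sup [set x%:E | x in [set x | F x < 1]].

(* [inf] is real-valued: this is the generalized inverse for 0 < u < 1, and
   a junk value when the set is empty or unbounded below. *)
Definition ginv (F : R -> R) (u : R) : R := inf [set x | u <= F x].

Definition eq_dist d1 (T1 : measurableType d1) (P1 : probability T1 R)
    d2 (T2 : measurableType d2) (P2 : probability T2 R)
    (X : T1 -> R) (Y : T2 -> R) : Prop :=
  forall A : set R, measurable A -> P1 (X @^-1` A) = P2 (Y @^-1` A).

End distribution_functions.

Section independence.
Context d (T : measurableType d) {R : realType} (P : probability T R).

Definition sigma_rv d' (T' : measurableType d') (X : T -> T') : set (set T) :=
  preimage_set_system setT X measurable.

Definition sigma_seq d' (T' : measurableType d') (X : nat -> T -> T') :
    set (set T) :=
  <<s \bigcup_i sigma_rv (X i) >>.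

Definition indep2 (G H : set (set T)) : Prop :=
  forall A B, G A -> H B -> P (A `&` B) = (P A * P B)%E.

Definition mutual_indep (I : eqType) (G : I -> set (set T)) : Prop :=
  forall (J : seq I) (A : I -> set T), uniq J ->
    (forall i, i \in J -> G i (A i)) ->
    P (\bigcap_(i in [set` J]) A i) = (\prod_(i <- J) P (A i))%E.

Definition indep_rv d1 (T1 : measurableType d1) d2 (T2 : measurableType d2)
    (X : T -> T1) (Y : T -> T2) : Prop :=
  indep2 (sigma_rv X) (sigma_rv Y).

End independence.

Section laws.
Context {R : realType}.
Local Notation leb := (@lebesgue_measure R).

Definition Gamma (r : R) : R :=
  \int[leb]_(t in `[0, +oo[) (t `^ (r - 1) * expR (- t)).

(* The value at the single point x = 0 depends on the convention for
   [0 `^ a] and is irrelevant, since only integrals of the density are used. *)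
Definition ggamma_pdf (r gam mu x : R) : R :=
  if 0 <= x then
    `|gam| * mu `^ r / Gamma r * x `^ (gam * r - 1) * expR (- (mu * x `^ gam))
  else 0.

Definition is_ggamma d (T : measurableType d) (P : probability T R)
    (X : T -> R) (r gam mu : R) : Prop :=
  forall A : set R, measurable A ->
    P (X @^-1` A) = (\int[leb]_(x in A) (ggamma_pdf r gam mu x)%:E)%E.

Definition is_gamma d (T : measurableType d) (P : probability T R)
    (X : T -> R) (r mu : R) : Prop := is_ggamma P X r 1 mu.

Definition is_weibull d (T : measurableType d) (P : probability T R)
    (X : T -> R) (gam : R) : Prop := is_ggamma P X 1 gam 1.

Definition is_gnb d (T : measurableType d) (P : probability T R)
    (N : T -> nat) (r gam mu : R) : Prop :=
  forall k : nat, P (N @^-1` [set k]) =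
    ((k`!%:R^-1)%:E * \int[leb]_(z in `[0%R, +oo[)
       (expR (- z) * z ^+ k * ggamma_pdf r gam mu z)%:E)%E.

End laws.

(* max {x_1, ..., x_m} with x_(i+1) encoded as [x i]; 0 when m = 0. The unit
   [x 0] of the iterated maximum is itself one of the terms when m > 0. *)
Definition max_first {R : realType} (x : nat -> R) (m : nat) : R :=
  if m is 0 then 0 else \big[Num.max/x 0%N]_(i < m) x i.

(* Main.v *)
From HB Require Import structures.
Require Import Defs.
From mathcomp Require Import measurable_realfun ring lra.

(** Every distribution function in the statement is expressed through the
Laplace transform L(s) = E exp(- s G) of a single generalized gamma variable G,
with parameters (r, gam, lam).

On the one hand, if W is a Weibull variable of exponent a independent of a
positive variable V, then P(V / W < x) = E exp(- (V / x) ^ a) for x > 0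
([ratio_law_conditioning], [weibull_tail]). Powers of generalized gamma
variables are generalized gamma ([ggamma_substitution]), so each of the three
ratios satisfies P(M < x) = L(x ^ (- alpha)) for x > 0 and P(M < x) = 0 for
x <= 0 ([ratio_law], [ratio_law_le0], [scaled_power_law]). Since a law is
determined by its values on rays ([eq_dist_ray]), the three laws coincide. No
value of the Gamma function at r is needed: the normalization of the densities
comes from the hypothesis that they are the densities of laws.

On the other hand, the number of terms is a Poisson mixture, so its generating
function is a Laplace transform ([gnb_pgf]). Conditioning on that number and
rescaling by n gives, for x > 0 and b n the quantile of order 1 - 1 / n,
P(max / b n < x) = L(n (1 - F(x b n))) ([prob_random_max]). Regular variation
of the tail and the definition of the quantile give
n (1 - F(x b n)) --> x ^ (- alpha) ([tail_ginv]), and L is continuous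
([ggamma_laplace_cvg]), hence pointwise convergence on ]0, +oo[.

Finally L takes all values in ]0, 1[ ([ggamma_laplace_surj]), so the limit
distribution function does too, and monotonicity upgrades pointwise convergence
to uniform convergence on [0, +oo[, the point 0 included ([polya]). *)

Set Implicit Arguments.
Unset Strict Implicit.
Unset Printing Implicit Defensive.

Local Open Scope classical_set_scope.
Local Open Scope ring_scope.

(** * Uniform convergence of distribution functions *)

Section polya.
Context {R : realType}.

(** Polya's argument. A level [v] in ]0, 1[ is required to be attained by [H]
at a point of pointwise convergence; this replaces continuity of [H] and its
limits 0 and 1. Points at the levels j / K then control all of [0, +oo[. *)
Lemma polya (F : nat -> R -> R) (H : R -> R) :
  (forall n x y, 0 <= x -> x <= y -> F n x <= F n y) ->
  (forall n x, 0 <= F n x <= 1) ->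
  (forall x y, 0 <= x -> x <= y -> H x <= H y) ->
  (forall x, 0 <= H x <= 1) ->
  (forall v, 0 < v < 1 -> exists x, [/\ 0 <= x, H x = v &
     F n x @[n --> \oo] --> H x]) ->
  sup [set `|F n x - H x| | x in [set x | 0 <= x]] @[n --> \oo] --> (0 : R).
Proof.
move=> F_nd F01 H_nd H01 HF.
apply/cvgrPdist_le => e e0.
(* Each of the three errors, two from the mesh and one from convergence at the
   grid points, is at most 1 / K. *)
pose K := (Num.trunc (3 / e)).+1.
have K0 : 0 < (K%:R : R) by rewrite ltr0n.
have Ke : 3 / K%:R <= e.
  rewrite ler_pdivrMr// mulrC -ler_pdivrMr//; exact/ltW/truncnS_gt.
have /choice[g gP] : forall j : 'I_K, exists x : R, (0 < j)%N ->
    [/\ 0 <= x, H x = j%:R / K%:R & F n x @[n --> \oo] --> H x].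
  move=> j; have [j0|j0] := posnP j; first by exists 0; rewrite j0.
  have [|x] := HF (j%:R / K%:R).
    by rewrite divr_gt0 ?ltr0n//= ltr_pdivrMr// mul1r ltr_nat.
  by exists x.
have : \forall n \near \oo, forall j : 'I_K, (0 < j)%N ->
    `|F n (g j) - H (g j)| <= K%:R^-1.
  apply: filter_forall => j; have [j0|j0] := posnP j.
    exact: nearW.
  have [_ _ /cvgrPdist_le/(_ K%:R^-1)] := gP j j0.
  rewrite invr_gt0 => /(_ K0); apply: filterS => n + _.
  by rewrite distrC.
apply: filterS => n nP.
have main x : 0 <= x -> `|F n x - H x| <= 3 / K%:R.
  move=> x0.
  have KH0 : 0 <= K%:R * H x by rewrite mulr_ge0 ?ler0n//; case/andP: (H01 x).
  pose j := Num.trunc (K%:R * H x).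
  have /andP[jH Hj] : j%:R <= K%:R * H x < j.+1%:R by exact: truncn_itv.
  have {}jH : j%:R / K%:R <= H x by rewrite ler_pdivrMr// mulrC.
  have {}Hj : H x < j.+1%:R / K%:R by rewrite ltr_pdivlMr// mulrC.
  have /andP[Hx0 Hx1] := H01 x.
  have /andP[Fx0 Fx1] := F01 n x.
  rewrite ler_norml; apply/andP; split.
  (* H x lies in [j / K, (j + 1) / K[; the lower bound is trivial for j <= 1 and
     otherwise uses the grid point of index j - 1, strictly to the left of x. *)
  - have [j1|j1] := leqP j 1.
      have : H x <= 2 / K%:R.
        by rewrite (le_trans (ltW Hj))// ler_pM2r ?invr_gt0// ler_nat ltnS.
      have : 0 <= K%:R^-1 :> R by rewrite invr_ge0 ltW.
      by lra.
    have jK : (j.-1 < K)%N.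
      rewrite -(ltr_nat R) -(@ltr_pM2r _ K%:R^-1) ?invr_gt0//.
      rewrite divff ?gt_eqF//; apply: lt_le_trans Hx1.
      apply: lt_le_trans jH; rewrite ltr_pM2r ?invr_gt0// ltr_nat.
      by rewrite prednK// (ltn_trans _ j1).
    have j0 : (0 < Ordinal jK)%N by rewrite /= -ltnS prednK// (ltn_trans _ j1).
    have [g0 Hg _] := gP _ j0; have := nP _ j0.
    have gx : g (Ordinal jK) <= x.
      rewrite leNgt; apply/negP => xg; have := H_nd _ _ x0 (ltW xg).
      apply/negP; rewrite -ltNge Hg (lt_le_trans _ jH)//.
      by rewrite ltr_pM2r ?invr_gt0// ltr_nat/= prednK// (ltn_trans _ j1).
    have := F_nd n _ _ g0 gx; rewrite Hg ler_norml => Fg /andP[+ _].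
    have -> : ((Ordinal jK : nat)%:R : R) = j%:R - 1.
      by rewrite /= -subn1 natrB// (ltn_trans _ j1).
    move: Hj; rewrite -natr1 !mulrDl mulNr !mul1r; lra.
  (* The upper bound uses the grid point of index j + 1, if there is one;
     otherwise H x is within 1 / K of 1. *)
  - have [Kj|jK] := leqP K j.+1.
      have : 1 <= j.+1%:R / K%:R :> R by rewrite ler_pdivlMr// mul1r ler_nat.
      move: jH; rewrite -natr1 mulrDl mul1r.
      have : 0 <= K%:R^-1 :> R by rewrite invr_ge0 ltW.
      by lra.
    have j0 : (0 < Ordinal jK)%N by [].
    have [g0 Hg _] := gP _ j0; have := nP _ j0.
    have gx : x <= g (Ordinal jK).
      rewrite leNgt; apply/negP => xg; have := H_nd _ _ g0 (ltW xg).
      by apply/negP; rewrite -ltNge Hg.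
    have := F_nd n _ _ x0 gx; rewrite Hg ler_norml => Fg /andP[_].
    rewrite /= -natr1 !mulrDl !mul1r.
    have : 0 <= K%:R^-1 :> R by rewrite invr_ge0 ltW.
    move: jH Fg; lra.
rewrite sub0r normrN ger0_norm.
- apply: ge_sup; first by exists `|F n 0 - H 0|; exists 0 => /=.
  by move=> _ [x /= x0 <-]; rewrite (le_trans (main _ x0)).
- apply: le_trans (normr_ge0 (F n 0 - H 0)) _; apply: ub_le_sup.
    by exists (3 / K%:R) => _ [x /= x0 <-]; exact: main.
  by exists 0 => /=.
Qed.

End polya.

(** * Power substitutions on the half-line *)

Section powR_substitution.
Context {R : realType}.
Local Notation leb := (@lebesgue_measure R).

Lemma continuous_powR (a x : R) : 0 < x -> {for x, continuous (@powR R ^~ a)}.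
Proof.
move=> x0; apply: differentiable_continuous; apply/derivable1_diffP.
by apply: derivable_powR; rewrite in_itv/= x0.
Qed.

Lemma bigcup_itvcc_pos :
  \bigcup_i `[(i.+1%:R : R)^-1, i.+1%:R]%classic = `]0, +oo[%classic.
Proof.
apply/seteqP; split => [x [i _] /=|x /=]; rewrite !in_itv/= ?andbT.
  by move=> /andP[+ _]; apply: lt_le_trans; rewrite invr_gt0 ltr0n.
move=> x0; pose m := Num.max x x^-1; exists (Num.trunc m) => //=.
have m1 : m <= (Num.trunc m).+1%:R by exact/ltW/truncnS_gt.
rewrite in_itv/= (le_trans _ m1) ?le_max ?lexx// andbT.
rewrite invf_ple ?posrE ?ltr0n//.
by rewrite (le_trans _ m1)// le_max lexx orbT.
Qed.

(** The substitution u = c * v ^ a. The derivative of the map may be unbounded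
at 0 and at +oo, so the change of variables is made on the segments
[1 / (i + 1), i + 1], and both sides pass to the limit by monotone
convergence. *)
Lemma powR_substitution (c a : R) (G : R -> R) : 0 < c -> 0 < a ->
  {in `]0, +oo[, continuous G} -> (forall u, 0 < u -> 0 <= G u) ->
  (\int[leb]_(u in `]0%R, +oo[) (G u)%:E =
   \int[leb]_(v in `]0%R, +oo[) (G (c * v `^ a) * (c * (a * v `^ (a - 1))))%:E)%E.
Proof.
move=> c0 a0 cG G0.
pose F v := c * v `^ a.
have F0 v : 0 < v -> 0 < F v by move=> v0; rewrite mulr_gt0// powR_gt0.
have ltF x y : 0 <= x -> x < y -> F x < F y.
  move=> x0 xy; rewrite ltr_pM2l// gt0_ltr_powR// nnegrE//.
  by rewrite (le_trans x0)// ltW.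
have leF x y : 0 <= x -> x <= y -> F x <= F y.
  by move=> x0; rewrite le_eqVlt => /predU1P[->//|xy]; rewrite ltW// ltF.
have cF (x : R) : 0 < x -> {for x, continuous F}.
  by move=> x0; apply: continuousM; [exact: cst_continuous|exact: continuous_powR].
have dF (x : R) : 0 < x -> is_derive x 1 F (c * (a * x `^ (a - 1))).
  by move=> x0; have := is_derive1_powR a x0 => ?; exact: is_deriveZ.
have F'E (x : R) : 0 < x -> F^`()%classic x = c * (a * x `^ (a - 1)).
  by move=> /dF ?; rewrite derive1E derive_val.
have cF' (x : R) : 0 < x -> {for x, continuous (fun x => c * (a * x `^ (a - 1)))}.
  move=> x0; apply: continuousM; first exact: cst_continuous.
  by apply: continuousM; [exact: cst_continuous|exact: continuous_powR].
have nearF' (x : R) : 0 < x ->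
    \forall y \near x, F^`()%classic y = c * (a * y `^ (a - 1)).
  by move=> x0; near=> y; apply: F'E; near: y; exact: lt_nbhsr.
have cF'x (x : R) : 0 < x -> {for x, continuous F^`()%classic}.
  move=> x0; rewrite /prop_for /continuous_at F'E//.
  apply: (cvg_trans _ (cF' _ x0)); apply: near_eq_cvg.
  by near=> y; apply/esym; near: y; exact: nearF'.
have cGF (x : R) : 0 < x -> {for x, continuous (G \o F)}.
  move=> x0; apply: continuous_comp; first exact: cF.
  by apply: cG; rewrite in_itv/= andbT F0.
pose e i : R := i.+1%:R^-1.
pose E i : R := i.+1%:R.
have e0 i : 0 < e i by rewrite invr_gt0 ltr0n.
have E0 i : 0 < E i by rewrite ltr0n.
have eE i : e i <= E i.
  by rewrite (@le_trans _ _ 1) ?invf_le1 ?ltr0n// ler1n.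
have le_e : {homo e : i j / (i <= j)%N >-> j <= i}.
  by move=> i j ij; rewrite lef_pV2 ?posrE ?ltr0n// ler_nat ltnS.
have le_E : {homo E : i j / (i <= j)%N >-> i <= j}.
  by move=> i j ij; rewrite ler_nat ltnS.
have FEG i : (\int[leb]_(x in `[F (e i), F (E i)]) (G x)%:E =
    \int[leb]_(x in `[e i, E i]) (G (F x) * (c * (a * x `^ (a - 1))))%:E)%E.
  rewrite integration_by_substitution_increasing//.
  - apply: eq_integral => x /[!inE]/=; rewrite in_itv/= => /andP[ex _].
    by rewrite [RHS]/= /GRing.mul/= F'E// (lt_le_trans _ ex).
  - move=> x y /[!in_itv]/= /andP[ex _] _; apply: ltF.
    by rewrite (le_trans _ ex)// ltW.
  - move=> x /[!in_itv]/= /andP[ex _]; apply: cF'x.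
    by rewrite (lt_trans _ ex).
  - by apply/cvg_ex; exists (F^`()%classic (e i)); exact/cvg_at_right_filter/cF'x.
  - apply/cvg_ex; exists (F^`()%classic (E i)); apply/cvg_at_left_filter/cF'x.
    by rewrite ltr0n.
  - split.
    + move=> x /[!in_itv]/= /andP[ex _].
      by apply: (@ex_derive _ _ _ _ _ _ _ (dF x _)); rewrite (lt_trans _ ex).
    + exact/cvg_at_right_filter/cF.
    + by apply/cvg_at_left_filter/cF; rewrite ltr0n.
  - apply: continuous_in_subspaceT => x /[!inE]/= /[!in_itv]/= /andP[ex _].
    by apply: cG; rewrite in_itv/= andbT (lt_le_trans _ ex)// F0.
have U1 := bigcup_itvcc_pos.
have U2 : \bigcup_i `[F (e i), F (E i)]%classic = `]0, +oo[%classic.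
  apply/seteqP; split => [x [i _] /=|x /=]; rewrite !in_itv/= ?andbT.
    by move=> /andP[+ _]; apply: lt_le_trans; rewrite F0.
  move=> x0.
  pose y := (x / c) `^ a^-1.
  have y0 : 0 < y by rewrite powR_gt0 ?divr_gt0.
  have Fy : F y = x.
    rewrite /F /y -powRrM mulVf ?gt_eqF// powRr1; last by rewrite divr_ge0 ?ltW.
    by rewrite mulrCA mulfV ?mulr1// gt_eqF.
  have : `]0, +oo[%classic y by rewrite /= in_itv/= y0.
  rewrite -U1 => -[i _ /=]; rewrite in_itv/= => /andP[ey yE]; exists i => //=.
  by rewrite in_itv/= -Fy !leF// ltW.
have mitv (f : R -> R) (p q : R) : 0 < p ->
    (forall x, 0 < x -> {for x, continuous f}) ->
    measurable_fun `[p, q] (EFin \o f).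
  move=> p0 cf; apply/measurable_EFinP.
  apply: subspace_continuous_measurable_fun => //.
  apply: continuous_in_subspaceT => x /[!inE]/= /[!in_itv]/= /andP[ex _].
  by apply: cf; exact: lt_le_trans ex.
have cv1 : (\int[leb]_(x in `[F (e i), F (E i)]) (G x)%:E @[i --> \oo] -->
    \int[leb]_(x in `]0%R, +oo[) (G x)%:E)%E.
  rewrite -U2; apply: ge0_nondecreasing_set_cvg_integral => //.
  + move=> i j ij; apply/subsetPset => x /=; rewrite !in_itv/= => /andP[Fx xF].
    rewrite (le_trans _ Fx) ?(le_trans xF)// leF ?le_E ?le_e ?(ltW (e0 _)) ?(ltW (E0 _))//.
  + by move=> i; apply: mitv => [|x x0]; [exact: F0|apply: cG; rewrite in_itv/= andbT x0].
  + move=> i x /=; rewrite in_itv/= => /andP[ex _]; rewrite lee_fin G0//.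
    by rewrite (lt_le_trans _ ex)// F0.
have cv2 : (\int[leb]_(x in `[e i, E i]) (G (F x) * (c * (a * x `^ (a - 1))))%:E
      @[i --> \oo] -->
    \int[leb]_(x in `]0%R, +oo[) (G (F x) * (c * (a * x `^ (a - 1))))%:E)%E.
  rewrite -[in X in _ --> X]U1; apply: ge0_nondecreasing_set_cvg_integral => //.
  + move=> i j ij; apply/subsetPset => x /=; rewrite !in_itv/= => /andP[Fx xF].
    by rewrite (le_trans _ Fx) ?(le_trans xF)// ?le_E ?le_e// ltW// ltr0n.
  + move=> i; apply: (mitv (fun x => G (F x) * (c * (a * x `^ (a - 1))))) => // x x0.
    by apply: continuousM; [exact: cGF|exact: cF'].
  + move=> i x /=; rewrite in_itv/= => /andP[ex _]; rewrite lee_fin.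
    have x0 : 0 < x by rewrite (lt_le_trans _ ex).
    by rewrite !mulr_ge0 ?G0 ?F0 ?powR_ge0 ?ltW.
rewrite -(cvg_lim _ cv1)// -(cvg_lim _ cv2)//.
by congr (lim (_ @ \oo)); apply/funext => i; exact: FEG.
Unshelve. all: by end_near. Qed.

End powR_substitution.

(** * Generalized gamma densities *)

Section pdf.
Context {R : realType}.
Local Notation leb := (@lebesgue_measure R).

(** The point 0 is negligible, so a density vanishing on the negative numbers
is only seen on ]0, +oo[. *)
Lemma ge0_integral_setI_pos (A : set R) (f : R -> \bar R) : measurable A ->
  measurable_fun [set: R] f -> (forall x, 0 <= f x)%E ->
  (forall x, x < 0 -> f x = 0%E) ->
  (\int[leb]_(x in A) f x = \int[leb]_(x in A `&` `]0%R, +oo[) f x)%E.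
Proof.
move=> mA mf f0 fneg.
rewrite integral_mkcond [RHS]integral_mkcondr -integral_mkcond.
rewrite (@ge0_negligible_integral _ _ _ _ _ [set (0 : measurableTypeR R)])//=; first last.
- exact: lebesgue_measure_set1.
- exact: measurable_funTS.
rewrite [RHS](@ge0_negligible_integral _ _ _ _ _ [set (0 : measurableTypeR R)])//=; first last.
- exact: lebesgue_measure_set1.
- by move=> x _; apply: erestrict_ge0.
- apply: measurable_funTS.
  apply/(measurable_restrictT f) => //; exact: measurable_funTS.
apply: eq_integral => x /[!inE] -[_ /= /eqP x0].
rewrite patchE; case: ifPn => //; rewrite notin_setE/= in_itv/= andbT => /negP.
by rewrite -leNgt le_eqVlt (negbTE x0)/= => /fneg.
Qed.

Lemma Gamma1 : Gamma (1 : R) = 1.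
Proof.
rewrite /Gamma /Rintegral.
rewrite (_ : (\int[leb]_(x in _) _)%E = (\int[leb]_x (exponential_pdf 1 x)%:E)%E).
  by rewrite integral_exponential_pdf.
rewrite [LHS]integral_mkcond; apply: eq_integral => x _.
rewrite /exponential_pdf !patchE; case: ifP => // _.
by rewrite subrr powRr0 !mul1r mulN1r.
Qed.

Lemma ggamma_pdf_ge0 (r g mu x : R) : 0 <= ggamma_pdf r g mu x.
Proof.
rewrite /ggamma_pdf; case: ifPn => // x0.
have : 0 <= Gamma r.
  by apply: Rintegral_ge0 => t; rewrite /= in_itv/= => _;
     rewrite mulr_ge0 ?powR_ge0 ?expR_ge0.
by move=> G0; rewrite !mulr_ge0 ?powR_ge0 ?expR_ge0 ?invr_ge0.
Qed.

Lemma ggamma_pdf_lt0 (r g mu x : R) : x < 0 -> ggamma_pdf r g mu x = 0.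
Proof. by rewrite /ggamma_pdf ltNge => /negbTE ->. Qed.

Lemma measurable_ggamma_pdf (r g mu : R) :
  measurable_fun [set: R] (ggamma_pdf r g mu).
Proof.
apply: measurable_fun_if => //=.
- by apply: measurable_fun_ler => //; exact: measurable_cst.
- apply: measurable_funTS; apply: measurable_funM.
    apply: measurable_funM; first exact: measurable_cst.
    exact: measurable_powR.
  apply: measurableT_comp => //; apply: measurableT_comp => //.
  by apply: measurable_funM => //; exact: measurable_powR.
Qed.

Lemma ggamma_pdfE (r g mu x : R) : 0 < x -> ggamma_pdf r g mu x =
  `|g| * mu `^ r / Gamma r * x `^ (g * r - 1) * expR (- (mu * x `^ g)).
Proof. by move=> /ltW x0; rewrite /ggamma_pdf x0. Qed.

(** If c * V ^ a has parameters (r, g, mu), then V has parameters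
(r, g * a, mu * c ^ g); this is the pointwise identity between densities,
Jacobian included. *)
Lemma ggamma_pdf_powR (r g mu c a v : R) :
  0 < g -> 0 < mu -> 0 < c -> 0 < a -> 0 < v ->
  ggamma_pdf r g mu (c * v `^ a) * (c * (a * v `^ (a - 1))) =
  ggamma_pdf r (g * a) (mu * c `^ g) v.
Proof.
move=> g0 mu0 c0 a0 v0.
have va0 : 0 < v `^ a by rewrite powR_gt0.
rewrite !ggamma_pdfE ?mulr_gt0// !gtr0_norm ?mulr_gt0//.
rewrite !powRM ?(ltW c0) ?(ltW mu0) ?(ltW va0) ?powR_ge0//.
rewrite -!powRrM.
rewrite (mulrC a g) mulrA.
have -> : expR (- (mu * c `^ g * v `^ (g * a))) = expR (- (mu * (c `^ g * v `^ (g * a)))).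
  by rewrite mulrA.
set ex := expR _.
have -> : v `^ (g * a * r - 1) = v `^ (a * (g * r - 1)) * v `^ (a - 1).
  by rewrite -powRD ?(gt_eqF v0) ?implybT//; congr (_ `^ _); ring.
have -> : c `^ (g * r) = c `^ (g * r - 1) * c.
  by rewrite -{3}(powRr1 (ltW c0)) -powRD ?(gt_eqF c0) ?implybT// subrK.
ring.
Qed.

Lemma continuous_ggamma_pdf (r g mu x : R) : 0 < x ->
  {for x, continuous (ggamma_pdf r g mu)}.
Proof.
move=> x0; rewrite /prop_for /continuous_at ggamma_pdfE//.
have cpow (b : R) : y `^ b @[y --> x] --> x `^ b.
  change {for x, continuous (@powR R ^~ b)}.
  apply: differentiable_continuous; apply/derivable1_diffP.
  by apply: derivable_powR; rewrite in_itv/= x0.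
apply: (@cvg_trans _ ((`|g| * mu `^ r / Gamma r * y `^ (g * r - 1) *
   expR (- (mu * y `^ g))) @[y --> x])).
  apply: near_eq_cvg; near=> y; rewrite ggamma_pdfE//.
  by near: y; exact: lt_nbhsr.
change {for x, continuous (fun y : R => `|g| * mu `^ r / Gamma r * y `^ (g * r - 1) *
  expR (- (mu * y `^ g)))}.
apply: continuousM.
  by apply: continuousM; [exact: cst_continuous|exact: cpow].
apply: (continuous_comp (f := fun y : R => - (mu * y `^ g)) (g := expR));
  last exact: continuous_expR.
apply: continuousN.
by apply: continuousM; [exact: cst_continuous|exact: cpow].
Unshelve. all: by end_near. Qed.

Lemma weibull_tail (a t : R) : 0 < a -> 0 < t ->
  (\int[leb]_(x in `]t, +oo[) (ggamma_pdf 1 a 1 x)%:E = (expR (- t `^ a))%:E)%E.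
Proof.
move=> a0 t0.
have fE x : 0 < x -> ggamma_pdf 1 a 1 x = a * x `^ (a - 1) * expR (- x `^ a).
  move=> x0; rewrite ggamma_pdfE// Gamma1 powR1 gtr0_norm// divr1 !mulr1.
  by rewrite mul1r.
have dF (x : R) : 0 < x ->
    is_derive x 1 (fun x => - expR (- x `^ a)) (a * x `^ (a - 1) * expR (- x `^ a)).
  move=> x0; have dp := is_derive1_powR a x0.
  have dN : is_derive x 1 (fun x => - x `^ a) (- (a * x `^ (a - 1))) by exact: is_deriveN.
  have dE : is_derive x 1 (expR \o (fun x => - x `^ a))
      (expR (- x `^ a) * - (a * x `^ (a - 1))).
    exact: is_derive1_comp.
  by apply: is_derive_eq; rewrite mulrN opprK mulrC.
have pos x : t <= x -> 0 < x by exact: lt_le_trans.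
have cf (x : R) : 0 < x -> {for x, continuous (ggamma_pdf 1 a 1)}.
  exact: continuous_ggamma_pdf.
rewrite integral_itv_obnd_cbnd; last first.
  apply: measurable_funTS; apply/measurable_EFinP; exact: measurable_ggamma_pdf.
rewrite (@ge0_continuous_FTC2y _ _ (fun x => - expR (- x `^ a)) _ 0)//.
- by rewrite sub0e EFinN oppeK.
- by move=> x _; exact: ggamma_pdf_ge0.
- apply: continuous_in_subspaceT => x /[!inE]/= /[!in_itv]/= /andP[/pos + _].
  exact: cf.
- rewrite -oppr0; apply: cvgN.
  apply: (@cvg_comp _ _ _ (fun x => x `^ a) (fun z => expR (- z)) _ (pinfty_nbhs R));
    last exact: cvgr_expR.
  apply/cvgryPge => A; near=> x.
  have A0 : 0 < `|A| + 1 by rewrite ltr_wpDl.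
  apply: (@le_trans _ _ (`|A| + 1)).
    by rewrite (le_trans (ler_norm _))// lerDl.
  rewrite -[leLHS](@powRr1 _ (`|A| + 1)) ?(ltW A0)// -[X in _ `^ X](@mulVf _ a) ?gt_eqF//.
  rewrite powRrM; apply: ge0_ler_powR; rewrite ?nnegrE ?powR_ge0 ?(ltW a0)//;
    (near: x; apply: nbhs_pinfty_ge; rewrite num_real).
- by move=> x tx; apply: (@ex_derive _ _ _ _ _ _ _ (dF x _)); rewrite (lt_trans t0).
- apply: cvg_at_right_filter.
  change {for t, continuous (fun x : R => - expR (- x `^ a))}.
  apply: differentiable_continuous; apply/derivable1_diffP.
  exact: (@ex_derive _ _ _ _ _ _ _ (dF t _)).
- move=> x; rewrite in_itv/= andbT => tx; have x0 : 0 < x by rewrite (lt_trans t0).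
  by rewrite derive1E; have := dF _ x0 => ?; rewrite derive_val fE.
Unshelve. all: by end_near. Qed.

End pdf.

(** * The Laplace transform of a generalized gamma density *)

Section laplace.
Context {R : realType}.
Local Notation leb := (@lebesgue_measure R).
Variables (r gam lam : R).
Local Notation p := (ggamma_pdf r gam lam).

(** Laplace transform E exp(- s G) of a generalized gamma variable G with
parameters [r, gam, lam]. As a real-valued integral it is meaningful for
0 <= s. *)
Definition ggamma_laplace (s : R) : R :=
  \int[leb]_(u in `]0, +oo[) (expR (- (s * u)) * p u).
Local Notation L := ggamma_laplace.

Hypothesis p1 : (\int[leb]_(u in `]0%R, +oo[) (p u)%:E = 1)%E.

Lemma measurable_laplace_integrand (s : R) :
  measurable_fun [set: R] (fun u => (expR (- (s * u)) * p u)%:E).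
Proof.
apply/measurable_EFinP; apply: measurable_funM; last exact: measurable_ggamma_pdf.
by apply: measurableT_comp => //; apply: measurableT_comp => //; exact: measurable_funM.
Qed.

Lemma integrable_ggamma_pdf : leb.-integrable `]0, +oo[ (EFin \o p).
Proof.
apply/integrableP; split.
  by apply: measurable_funTS; apply/measurable_EFinP; exact: measurable_ggamma_pdf.
under eq_integral do rewrite gee0_abs ?lee_fin ?ggamma_pdf_ge0//.
by rewrite p1 ltry.
Qed.

Lemma laplace_le (s u : R) : 0 <= s -> 0 < u -> expR (- (s * u)) * p u <= p u.
Proof.
move=> s0 u0; rewrite ler_piMl ?ggamma_pdf_ge0// expR_le1 oppr_le0.
by rewrite mulr_ge0// ltW.
Qed.

Lemma ggamma_laplace_le1 (s : R) : 0 <= s ->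
  (\int[leb]_(u in `]0%R, +oo[) (expR (- (s * u)) * p u)%:E <= 1)%E.
Proof.
move=> s0; rewrite -p1; apply: ge0_le_integral => //.
- by move=> x _; rewrite lee_fin mulr_ge0 ?expR_ge0 ?ggamma_pdf_ge0.
- by apply: measurable_funTS; exact: measurable_laplace_integrand.
- by apply: measurable_funTS; apply/measurable_EFinP; exact: measurable_ggamma_pdf.
- by move=> x; rewrite /= in_itv/= andbT => x0; rewrite lee_fin laplace_le.
Qed.

Lemma EFin_ggamma_laplace (s : R) : 0 <= s ->
  (L s)%:E = (\int[leb]_(u in `]0%R, +oo[) (expR (- (s * u)) * p u)%:E)%E.
Proof.
move=> s0; rewrite /L /Rintegral fineK// ge0_fin_numE; last first.
  by apply: integral_ge0 => x _; rewrite lee_fin mulr_ge0 ?expR_ge0 ?ggamma_pdf_ge0.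
by rewrite (le_lt_trans (ggamma_laplace_le1 s0))// ltry.
Qed.

Lemma ggamma_laplace0 : L 0 = 1.
Proof.
apply: EFin_inj; rewrite EFin_ggamma_laplace// -p1.
by apply: eq_integral => u _; rewrite mul0r oppr0 expR0 mul1r.
Qed.

(** Dominated convergence under the transform, the density itself being the
dominating function; [phi] is the pointwise limit of the exponentials. *)
Lemma ggamma_laplace_dominated (s : nat -> R) (phi : R -> R) : (forall n, 0 <= s n) ->
  (forall u, 0 < u -> expR (- (s n * u)) @[n --> \oo] --> phi u) ->
  L (s n) @[n --> \oo] --> \int[leb]_(u in `]0, +oo[) (phi u * p u).
Proof.
move=> s0 sphi; apply: fine_cvg.
have H : (\int[leb]_(u in `]0%R, +oo[) (expR (- (s n * u)) * p u)%:E @[n --> \oo] -->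
    \int[leb]_(u in `]0%R, +oo[) (phi u * p u)%:E)%E.
  apply: (@dominated_cvg _ _ _ leb _ _ _ _ (EFin \o p)) => //=.
  - by move=> n; apply: measurable_funTS; exact: measurable_laplace_integrand.
  - move=> u; rewrite in_itv/= andbT => u0; apply: cvg_EFin; first exact: nearW.
    apply: cvgMl; exact: sphi.
  - exact: integrable_ggamma_pdf.
  - move=> n u; rewrite in_itv/= andbT => u0; rewrite lee_fin ger0_norm.
      by rewrite laplace_le.
    by rewrite mulr_ge0 ?expR_ge0 ?ggamma_pdf_ge0.
have cH := cvgP _ H.
rewrite fineK// ge0_fin_numE; last first.
  rewrite -(cvg_lim _ H)//; apply: lime_ge => //; apply: nearW => n.
  by apply: integral_ge0 => x _; rewrite lee_fin mulr_ge0 ?expR_ge0 ?ggamma_pdf_ge0.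
apply: (@le_lt_trans _ _ 1%E); last by rewrite ltry.
rewrite -(cvg_lim _ H)//; apply: lime_le => //; apply: nearW => n.
by rewrite ggamma_laplace_le1.
Qed.

Lemma ggamma_laplace_cvg (s : nat -> R) (t : R) : (forall n, 0 <= s n) ->
  s n @[n --> \oo] --> t -> L (s n) @[n --> \oo] --> L t.
Proof.
move=> s0 st; apply: (@ggamma_laplace_dominated s (fun u => expR (- (t * u)))) => // u u0.
apply: (@cvg_comp _ _ _ (fun n => - (s n * u)) expR _ (nbhs (- (t * u))));
  last exact: continuous_expR.
by apply: cvgN; exact: cvgMl.
Qed.

Lemma ggamma_laplace_cvg0 : L n%:R @[n --> \oo] --> (0 : R).
Proof.
have -> : (0 : R) = \int[leb]_(u in `]0, +oo[) (0 * p u).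
  by rewrite /Rintegral integral0_eq// => u _; rewrite mul0r.
apply: ggamma_laplace_dominated => // u u0.
apply: (@cvg_comp _ _ _ (fun n : nat => n%:R * u) (fun z => expR (- z)) _ (pinfty_nbhs R));
  last exact: cvgr_expR.
apply/cvgryPge => A; near=> n.
rewrite -ler_pdivrMr//; near: n; exact: nbhs_infty_ger.
Unshelve. all: by end_near.
Qed.

(** The transform is continuous, equal to 1 at 0 and tends to 0 at infinity. *)
Lemma ggamma_laplace_surj (v : R) : 0 < v < 1 -> exists2 s, 0 < s & L s = v.
Proof.
move=> /andP[v0 v1].
have [n Ln] : exists n : nat, L n%:R < v.
  have /cvgrPdist_lt/(_ v v0)[n _ /(_ n (leqnn n))] := ggamma_laplace_cvg0.
  by rewrite sub0r normrN => /(le_lt_trans (ler_norm _)); exists n.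
have cL : continuous (fun s : R => L `|s|).
  move=> t; apply/(@cvg_nbhsP _ R^o) => w wt.
  apply: ggamma_laplace_cvg => //; exact: cvg_norm.
have [||s] := @IVT R (fun s => L `|s|) 0 n%:R v (ler0n _ _).
- exact: continuous_subspaceT.
- by rewrite !ger0_norm// ggamma_laplace0 ge_min le_max (ltW Ln) (ltW v1) orbT.
rewrite in_itv/= => /andP[s0 _]; rewrite ger0_norm// => Ls.
exists s => //; rewrite lt_neqAle s0 andbT; apply: contraPneq Ls => <-.
by rewrite ggamma_laplace0 => /eqP; rewrite gt_eqF.
Qed.

End laplace.

(** * Laws, densities and independence *)

Lemma measurable_lt_ray d (T : measurableType d) (R : realType) (f : T -> R) (x : R) :
  measurable_fun [set: T] f -> measurable [set w | f w < x].
Proof.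
move=> /(_ measurableT `]-oo, x[%classic (measurable_itv _)); rewrite setTI.
by congr measurable; apply/seteqP; split => p /=; rewrite in_itv.
Qed.

Lemma measurable_inv (R : realType) : measurable_fun [set: R] (@GRing.inv R).
Proof.
rewrite -(setvU [set (0 : R)]); apply/measurable_funU => //.
  exact: measurableC.
split; last exact: measurable_fun_set1.
apply: open_continuous_measurable_fun; first by apply: closed_openC; exact: closed_eq.
by move=> x /[!inE]/= /eqP x0; exact: inv_continuous.
Qed.

Lemma measurable_fun_div d (T : measurableType d) (R : realType) (f g : T -> R) :
  measurable_fun [set: T] f -> measurable_fun [set: T] g ->
  measurable_fun [set: T] (fun w => f w / g w).
Proof.
move=> mf mg; apply: measurable_funM => //.
by apply: (measurableT_comp (@measurable_inv R)).
Qed.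

(** A probability on the line is determined by its values on the open rays
]-oo, x[. *)
Lemma eq_probability_ray (R : realType) (m1 m2 : probability R R) :
  (forall x : R, m1 [set y | y < x] = m2 [set y | y < x]) ->
  forall A : set R, measurable A -> m1 A = m2 A.
Proof.
move=> m12; apply: (measure_unique (@RGenInftyO.G R) (fun n => `]-oo, n%:R[%classic)).
- exact: RGenInftyO.measurableE.
- move=> _ _ [x ->] [y ->]; exists (Num.min x y).
  by apply/seteqP; split => z /=; rewrite !in_itv/= lt_min => /andP.
- by move=> n; exists n%:R.
- apply/seteqP; split => // x _; exists (Num.trunc x).+1 => //=.
  by rewrite in_itv/= truncnS_gt.
- move=> _ [x ->].
  have -> : `]-oo, x[%classic = [set y | y < x].
    by apply/seteqP; split => y /=; rewrite in_itv.
  exact: m12.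
- by move=> n; apply: le_lt_trans (probability_le1 _ _) _ => //; rewrite ltry.
Qed.

Lemma measurable_rv_ray d (T : measurableType d) (R : realType)
  (P : probability T R) (X : {RV P >-> R}) (x : R) : measurable [set w | X w < x].
Proof. exact: measurable_lt_ray. Qed.

Section joint.
Context d (T : measurableType d) (R : realType) (P : probability T R).
Context d1 (T1 : measurableType d1) d2 (T2 : measurableType d2).
Variables (X : {RV P >-> T1}) (Y : {RV P >-> T2}).

Let XY w := (X w, Y w).
Let mXY : measurable_fun [set: T] XY.
Proof. by apply/measurable_fun_pair. Qed.
Let XY_mixin := isMeasurableFun.Build _ _ _ _ _ mXY.
Let XY_pack : {mfun T >-> (T1 * T2)%type} := HB.pack XY XY_mixin.

(** The joint law of independent variables is the product of their laws. *)
Lemma indep_rv_joint (B : set (T1 * T2)) : indep_rv P X Y -> measurable B ->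
  P [set w | B (X w, Y w)] = ((distribution P X) \x (distribution P Y))%E B.
Proof.
move=> XYind mB.
rewrite (@product_measure_unique _ _ _ _ _ (distribution P X) (distribution P Y)
  (distribution P XY_pack))// => A1 A2 mA1 mA2.
apply: XYind; [exists A1|exists A2] => //; exact: setTI.
Qed.
End joint.

Section density.
Context d (T : measurableType d) (R : realType) (P : probability T R).
Local Notation leb := (@lebesgue_measure R).

(** The integral of h(X) is computed with the density [f] of X: [f] agrees
almost everywhere with the Radon-Nikodym derivative of the law of X with
respect to the Lebesgue measure. *)
Lemma integral_comp_density (X : {RV P >-> R}) (f : R -> R) (h : R -> \bar R) :
  measurable_fun [set: R] f -> (forall x, 0 <= f x) ->
  (forall A, measurable A -> P (X @^-1` A) = \int[leb]_(x in A) (f x)%:E)%E ->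
  measurable_fun [set: R] h -> P.-integrable [set: T] (h \o X) ->
  (\int[P]_w h (X w) = \int[leb]_x (h x * (f x)%:E))%E.
Proof.
move=> mf f0 Xf mh ih.
have mEf : measurable_fun [set: R] (EFin \o f) by exact/measurable_EFinP.
have intf : leb.-integrable [set: R] (EFin \o f).
  apply/integrableP; split => //.
  under eq_integral do rewrite gee0_abs ?lee_fin//.
  by rewrite -Xf// preimage_setT probability_setT ltry.
(* The Lebesgue measure lives on [measurableTypeR R], whose display differs from
   that of [R]; the law of X is transported there. *)
have mX' : measurable_fun [set: T] (X : T -> measurableTypeR R).
  by move=> mT A mA; have := @measurable_funPT _ _ _ _ X; apply.
pose X'_mixin := isMeasurableFun.Build _ _ _ _ _ mX'.
pose X' : {mfun T >-> measurableTypeR R} := HB.pack (X : T -> measurableTypeR R) X'_mixin.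
pose nu : {finite_measure set (measurableTypeR R) -> \bar R} :=
  distribution P X'.
have dom : nu `<< leb.
  apply/null_content_dominatesP => A mA A0; rewrite /nu /= /distribution /pushforward Xf//.
  by apply: null_set_integral => //; exact: measurable_funTS.
have inu : nu.-integrable [set: measurableTypeR R] h by exact: integrable_pushforward.
transitivity (\int[nu]_x h x)%E.
  by rewrite integral_distribution.
rewrite -(Radon_Nikodym_change_of_variables dom)//.
apply: ae_eq_integral => //.
- exact: emeasurable_funM.
- by apply: emeasurable_funM.
- apply: ae_eqe_mul2l => /=.
  apply: integral_ae_eq => //=; first exact: Radon_Nikodym_integrable.
  by move=> E _ mE; rewrite -Xf// -Radon_Nikodym_integral.
Qed.

End density.

(** * Ratios of a generalized gamma and a Weibull variable *)

Section ggamma_substitution.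
Context {R : realType}.
Local Notation leb := (@lebesgue_measure R).

Lemma ggamma_substitution (r g mu c a : R) (h : R -> R) :
  0 < g -> 0 < mu -> 0 < c -> 0 < a ->
  {in `]0, +oo[, continuous h} -> (forall u, 0 < u -> 0 <= h u) ->
  (\int[leb]_(u in `]0%R, +oo[) (h u * ggamma_pdf r g mu u)%:E =
   \int[leb]_(v in `]0%R, +oo[)
     (h (c * v `^ a) * ggamma_pdf r (g * a) (mu * c `^ g) v)%:E)%E.
Proof.
move=> g0 mu0 c0 a0 ch h0; rewrite (powR_substitution c0 a0)/=; last 2 first.
- move=> u u0; apply: continuousM; first exact: ch.
  by apply: continuous_ggamma_pdf; move: u0; rewrite in_itv/= andbT.
- by move=> u u0; rewrite mulr_ge0 ?h0 ?ggamma_pdf_ge0.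
apply: eq_integral => v /[!inE]/= /[!in_itv]/= /[!andbT] v0.
by rewrite -mulrA ggamma_pdf_powR.
Qed.

Lemma ggamma_mass (r g mu c a : R) :
  0 < g -> 0 < mu -> 0 < c -> 0 < a ->
  (\int[leb]_(u in `]0%R, +oo[) (ggamma_pdf r g mu u)%:E = 1 ->
   \int[leb]_(u in `]0%R, +oo[) (ggamma_pdf r (g * a) (mu * c `^ g) u)%:E = 1)%E.
Proof.
move=> g0 mu0 c0 a0 <-.
have := @ggamma_substitution r g mu c a (fun=> 1) g0 mu0 c0 a0.
under eq_integral do rewrite mul1r.
under [X in _ -> _ -> _ = X]eq_integral do rewrite mul1r.
by move=> -> // x _; exact: cst_continuous.
Qed.

End ggamma_substitution.

Section ratio.
Context d (T : measurableType d) (R : realType) (P : probability T R).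
Local Notation leb := (@lebesgue_measure R).

Lemma ggamma_law_pos (X : {RV P >-> R}) (r g mu : R) (A : set R) :
  is_ggamma P X r g mu -> measurable A ->
  (P (X @^-1` A) = \int[leb]_(x in A `&` `]0%R, +oo[) (ggamma_pdf r g mu x)%:E)%E.
Proof.
move=> Xlaw mA; rewrite Xlaw// ge0_integral_setI_pos//.
- by apply/measurable_EFinP; exact: measurable_ggamma_pdf.
- by move=> x; rewrite lee_fin ggamma_pdf_ge0.
- by move=> x x0; rewrite ggamma_pdf_lt0.
Qed.

Lemma ggamma_law_mass (X : {RV P >-> R}) (r g mu : R) :
  is_ggamma P X r g mu ->
  (\int[leb]_(x in `]0%R, +oo[) (ggamma_pdf r g mu x)%:E = 1)%E.
Proof.
move=> /ggamma_law_pos/(_ measurableT); rewrite setTI => <-.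
by rewrite preimage_setT probability_setT.
Qed.

Variables (G W : {RV P >-> R}) (r g mu a : R).
Hypotheses (g0 : 0 < g) (mu0 : 0 < mu) (a0 : 0 < a).
Hypotheses (Glaw : is_ggamma P G r g mu) (Wlaw : is_weibull P W a).
Hypothesis GW : indep_rv P G W.

(** P(G / W < x), obtained by conditioning on G = u. *)
Lemma ratio_law_conditioning (x : R) :
  (P [set w | (G w / W w < x)%R] =
   \int[leb]_(u in `]0%R, +oo[)
     (P (W @^-1` [set y | (u / y < x)%R]) * (ggamma_pdf r g mu u)%:E))%E.
Proof.
pose B : set (R * R) := [set p | p.1 / p.2 < x].
have mB : measurable B by apply: measurable_lt_ray; exact: measurable_fun_div.
rewrite [LHS](indep_rv_joint GW mB) /product_measure1 ge0_integral_distribution//; last first.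
  exact: measurable_fun_xsection.
pose h := (distribution P W : set R -> \bar R) \o xsection B.
have mh : measurable_fun [set: R] h by exact: measurable_fun_xsection.
have h0 u : (0 <= h u)%E by [].
have ih : P.-integrable [set: T] (h \o G).
  apply: (@le_integrable _ _ _ P _ measurableT _ (cst 1%E)).
  - exact: measurableT_comp.
  - move=> w _ /=; rewrite !gee0_abs//.
    rewrite normr1; apply: (@probability_le1 _ _ _ (distribution P W)).
    exact: measurable_xsection.
  - exact: finite_measure_integrable_cst.
have E := integral_comp_density (measurable_ggamma_pdf r g mu)
  (ggamma_pdf_ge0 r g mu) Glaw mh ih.
transitivity (\int[leb]_u (h u * (ggamma_pdf r g mu u)%:E))%E; first exact: E.
rewrite ge0_integral_setI_pos//; first last.
- by move=> u u0; rewrite ggamma_pdf_lt0// mule0.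
- by move=> u; rewrite mule_ge0// lee_fin ggamma_pdf_ge0.
- apply: emeasurable_funM => //; apply/measurable_EFinP.
  exact: measurable_ggamma_pdf.
rewrite setTI; apply: eq_integral => u _.
rewrite /h /= /distribution /pushforward; congr (P _ * _)%E.
by apply/seteqP; split => w /=; rewrite /xsection /= inE.
Qed.

Lemma measurable_div_ray (u x : R) : measurable [set y : R | u / y < x].
Proof. by apply: measurable_lt_ray; exact: measurable_fun_div. Qed.

Lemma ratio_law_le0 (x : R) : x <= 0 -> P [set w | (G w / W w < x)%R] = 0%E.
Proof.
move=> x0; rewrite ratio_law_conditioning; apply: integral0_eq => u.
rewrite /= in_itv/= andbT => u0.
rewrite (ggamma_law_pos Wlaw (measurable_div_ray u x)).
rewrite (_ : _ `&` _ = set0) ?integral_set0 ?mul0e//.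
apply/seteqP; split => // y [/= + /[!in_itv]/= /[!andbT] y0].
by apply/negP; rewrite -leNgt (le_trans x0)// divr_ge0// ltW.
Qed.

(** P(G / W < x) = E exp(- (G / x) ^ a), and G = c * V ^ (1 / a) turns the
right-hand side into the Laplace transform of V at (c / x) ^ a. The scale [c]
is free, so that the transforms of differently parametrized variables can be
brought to a common form. *)
Lemma ratio_law (c x : R) : 0 < c -> 0 < x ->
  (P [set w | (G w / W w < x)%R] =
   (ggamma_laplace r (g / a) (mu * c `^ g) ((c / x) `^ a))%:E)%E.
Proof.
move=> c0 x0.
rewrite EFin_ggamma_laplace ?powR_ge0//; last first.
  by apply: ggamma_mass => //; [rewrite invr_gt0|exact: ggamma_law_mass Glaw].
rewrite ratio_law_conditioning.
transitivity (\int[leb]_(u in `]0%R, +oo[)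
   (expR (- (u / x) `^ a) * ggamma_pdf r g mu u)%:E)%E.
  apply: eq_integral => u /[!inE]/= /[!in_itv]/= /[!andbT] u0.
  rewrite EFinM -weibull_tail ?divr_gt0//; congr (_ * _)%E.
  rewrite (ggamma_law_pos Wlaw (measurable_div_ray u x)).
  congr (integral _ _ _); apply/seteqP; split => y /=; rewrite !in_itv/= !andbT.
    by move=> [+ y0]; rewrite ltr_pdivrMr// ltr_pdivrMr// mulrC.
  move=> uxy; have y0 : 0 < y by rewrite (lt_trans _ uxy)// divr_gt0.
  by split => //; move: uxy; rewrite ltr_pdivrMr// ltr_pdivrMr// mulrC.
rewrite (@ggamma_substitution _ r g mu c a^-1 (fun u => expR (- (u / x) `^ a))) ?invr_gt0//.
- apply: eq_integral => v /[!inE]/= /[!in_itv]/= /[!andbT] v0.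
  suff -> : (c * v `^ a^-1 / x) `^ a = (c / x) `^ a * v by [].
  rewrite mulrAC [LHS]powRM ?powR_ge0 ?divr_ge0 ?ltW//.
  by rewrite -powRrM mulVf ?gt_eqF// powRr1// ltW.
- move=> u; rewrite in_itv/= andbT => u0.
  apply: (continuous_comp (f := fun u : R => - (u / x) `^ a) (g := expR));
    last exact: continuous_expR.
  apply: continuousN.
  apply: (continuous_comp (f := fun u : R => u / x) (g := @powR R ^~ a)).
    by apply: continuousM => //; exact: cst_continuous.
  by apply: continuous_powR; rewrite divr_gt0.
Qed.

End ratio.

(** * Maxima over a generalized negative binomial number of terms *)

Section mixture.
Context {R : realType}.
Local Notation leb := (@lebesgue_measure R).

Lemma expR_eseries (x : R) : 0 <= x ->
  (\sum_(k <oo) (x ^+ k / k`!%:R)%:E = (expR x)%:E)%E.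
Proof.
move=> x0.
have cv : cvgn (series (exp_coeff x)) by exact: is_cvg_series_exp_coeff.
transitivity (limn (EFin \o series (exp_coeff x))); last exact: EFin_lim.
by apply/congr_lim/funext => n /=; rewrite /series /= -sumEFin.
Qed.

(** Probability generating function of the generalized negative binomial law:
as a Poisson mixture, it is the Laplace transform of the mixing density at
1 - q. *)
Lemma gnb_pgf (r g mu q : R) : 0 <= q ->
  (\sum_(k <oo) ((k`!%:R^-1)%:E * (\int[leb]_(z in `[0%R, +oo[)
     (expR (- z) * z ^+ k * ggamma_pdf r g mu z)%:E) * (q ^+ k)%:E) =
   \int[leb]_(z in `]0%R, +oo[) (expR (- ((1 - q) * z)) * ggamma_pdf r g mu z)%:E)%E.
Proof.
move=> q0.
have mk k : measurable_fun [set: R]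
    (fun z : R => (expR (- z) * z ^+ k * ggamma_pdf r g mu z)%:E).
  apply/measurable_EFinP; apply: measurable_funM; last exact: measurable_ggamma_pdf.
  apply: measurable_funM; last exact: exprn_measurable.
  by apply: measurableT_comp => //; exact: oppr_measurable.
transitivity (\sum_(k <oo) \int[leb]_(z in `]0%R, +oo[)
   ((k`!%:R^-1 * q ^+ k)%:E * (expR (- z) * z ^+ k * ggamma_pdf r g mu z)%:E))%E.
  apply: eq_eseriesr => k _.
  rewrite -integral_itv_obnd_cbnd; last by apply: measurable_funTS; exact: mk.
  rewrite ge0_integralZl//.
  - by rewrite muleAC -EFinM.
  - by apply: measurable_funTS; exact: mk.
  - move=> z; rewrite /= in_itv/= andbT => z0; rewrite lee_fin.
    by rewrite !mulr_ge0 ?expR_ge0 ?ggamma_pdf_ge0// exprn_ge0// ltW.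
  - by rewrite lee_fin mulr_ge0 ?invr_ge0 ?exprn_ge0.
rewrite -integral_nneseries//; last 2 first.
- by move=> k; apply: measurable_funTS; apply: measurable_funeM; exact: mk.
- move=> k z; rewrite /= in_itv/= andbT => z0; rewrite -EFinM lee_fin.
  rewrite !mulr_ge0 ?invr_ge0 ?(exprn_ge0 _ q0) ?expR_ge0 ?ggamma_pdf_ge0//.
  by rewrite exprn_ge0// ltW.
apply: eq_integral => z /[!inE]/= /[!in_itv]/= /[!andbT] z0.
under eq_eseriesr.
  move=> k _; rewrite -EFinM.
  rewrite (_ : k`!%:R^-1 * q ^+ k * _ =
    expR (- z) * ggamma_pdf r g mu z * ((q * z) ^+ k / k`!%:R)); last first.
    by rewrite exprMn; ring.
  rewrite EFinM; over.
rewrite nneseriesZl; last first.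
  by move=> k _; rewrite lee_fin divr_ge0// exprn_ge0// mulr_ge0// ltW.
rewrite expR_eseries ?mulr_ge0 ?(ltW z0)//.
by rewrite -EFinM mulrAC -expRD; congr (expR _ * _)%:E; ring.
Qed.

End mixture.

Section max_first.
Context {R : realType}.

(** For y > 0 the empty maximum 0 also satisfies the equivalence. *)
Lemma max_first_lt (x : nat -> R) (m : nat) (y : R) : 0 < y ->
  (max_first x m < y) <-> (forall i, (i < m)%N -> x i < y).
Proof.
move=> y0; rewrite /max_first; case: m => [|m]; first by split.
split => [xy i im|xy].
  by apply: le_lt_trans xy; rewrite (bigmax_sup (Ordinal im)).
by apply: bigmax_lt => [|i _]; exact: xy.
Qed.

Lemma measurable_max_first d (T : measurableType d) (f : nat -> T -> R) (m : nat) :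
  (forall i, measurable_fun [set: T] (f i)) ->
  measurable_fun [set: T] (fun w => max_first (fun i => f i w) m).
Proof.
move=> mf; rewrite /max_first; case: m => [|m]; first exact: measurable_cst.
elim: (index_enum _) => [|i s IHs].
  by rewrite (_ : (fun _ => _) = f 0%N)//; apply/funext => w; rewrite big_nil.
rewrite (_ : (fun _ => _) =
  (fun w => Num.max (f i w) (\big[Num.max/f 0%N w]_(j <- s) f j w))).
  by apply: measurable_maxr.
by apply/funext => w; rewrite big_cons.
Qed.

End max_first.

Section random_max.
Context d (T : measurableType d) (R : realType) (P : probability T R).
Local Notation leb := (@lebesgue_measure R).
Variables (X : nat -> {RV P >-> R}) (N : {RV P >-> nat}) (F : R -> R).
Hypothesis X_indep : mutual_indep P (fun i => sigma_rv (X i)).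
Hypothesis X_df : forall i x, dfun P (X i) x = F x.
Hypothesis NX_indep : indep2 P (sigma_rv N) (sigma_seq (fun i w => X i w)).

Lemma sigma_rv_ray i y : sigma_rv (X i) [set w | X i w < y].
Proof.
exists `]-oo, y[%classic => //; rewrite setTI.
by apply/seteqP; split => w /=; rewrite in_itv.
Qed.

Lemma sigma_seq_bigcap m y :
  sigma_seq (fun i w => X i w) [set w | forall i, (i < m)%N -> X i w < y].
Proof.
have -> : [set w | forall i, (i < m)%N -> X i w < y] =
    \bigcap_(i in [set i | (i < m)%N]) [set w | X i w < y].
  by apply/seteqP; split => w /=.
pose S := g_sigma_algebraType (\bigcup_i sigma_rv (fun w => X i w)).
apply: (@bigcap_measurableType _ S) => // i _.
by apply: sub_sigma_algebra; exists i => //; exact: sigma_rv_ray.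
Qed.

Lemma prob_max_lt m y :
  (P [set w | forall i, (i < m)%N -> (X i w < y)%R] = (F y ^+ m)%:E)%E.
Proof.
rewrite (_ : [set w | _] = \bigcap_(i in [set` iota 0 m]) [set w | X i w < y]); last first.
  apply/seteqP; split => w /= H i /=.
    by rewrite mem_iota; exact: H.
  by move=> im; apply: H; rewrite /= mem_iota.
rewrite (X_indep (iota_uniq 0 m)); last by move=> i _; exact: sigma_rv_ray.
rewrite (eq_bigr (fun=> (F y)%:E)); last first.
  move=> i _; rewrite -(X_df i y) /dfun fineK//.
  by apply: fin_num_measure; exact: measurable_lt_ray.
rewrite prodEFin; congr EFin.
by rewrite big_const_seq count_predT size_iota -Monoid.iteropE.
Qed.

Lemma measurable_max_event (b x : R) :
  measurable [set w | max_first (fun i => X i w) (N w) / b < x].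
Proof.
rewrite (_ : [set w | _] = \bigcup_k (N @^-1` [set k] `&`
    [set w | max_first (fun i => X i w) k / b < x])); last first.
  apply/seteqP; split => w /=; first by exists (N w).
  by move=> [k _ [/= ->]].
apply: bigcup_measurable => k _; apply: measurableI.
  by rewrite -[X in measurable X]setTI; exact: (@measurable_funPT _ _ _ _ N).
apply: measurable_lt_ray; apply: measurable_funM => //.
exact: measurable_max_first.
Qed.

(** Summing over the values k of N, independence gives the terms
P(N = k) * F(x b) ^ k. *)
Lemma prob_random_max (r g mu b x : R) : 0 < b -> 0 < x ->
  is_gnb P N r g mu ->
  (P [set w | (max_first (fun i => X i w) (N w) / b < x)%R] =
   \int[leb]_(z in `]0%R, +oo[)
     (expR (- ((1 - F (x * b)) * z)) * ggamma_pdf r g mu z)%:E)%E.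
Proof.
move=> b0 x0 Ngnb; have y0 : 0 < x * b by rewrite mulr_gt0.
have F0 : 0 <= F (x * b) by rewrite -(X_df 0); exact: fine_ge0.
rewrite -gnb_pgf//.
have mN k : measurable (N @^-1` [set k]).
  by rewrite -[X in measurable X]setTI; exact: (@measurable_funPT _ _ _ _ N).
have sub m : measurable [set w | forall i, (i < m)%N -> X i w < x * b].
  have -> : [set w | forall i, (i < m)%N -> X i w < x * b] =
    \bigcap_(i in [set i | (i < m)%N]) [set w | X i w < x * b].
    by apply/seteqP; split => w /=.
  by apply: bigcap_measurableType => // i _; exact: measurable_lt_ray.
rewrite (_ : [set w | _] = \bigcup_k (N @^-1` [set k] `&`
    [set w | forall i, (i < k)%N -> X i w < x * b])); last first.
  apply/seteqP; split => w /=; rewrite ltr_pdivrMr//.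
    by move=> /max_first_lt H; exists (N w) => //; split => //; exact: H.
  by move=> [k _ [/= ->]] H; apply/max_first_lt.
rewrite measure_bigcup//; last 2 first.
- by move=> k _; exact: measurableI.
- by apply/trivIsetP => i j _ _ ij;
  apply/seteqP; split => // w [[/= ? _] [/= ? _]]; subst; move/eqP: ij.
rewrite (eq_eseriesl (Q := xpredT)); last by move=> k; rewrite in_setT.
apply: eq_eseriesr => k _.
transitivity (P (N @^-1` [set k]) *
    P [set w | forall i, (i < k)%N -> (X i w < x * b)%R])%E.
  by apply: NX_indep; [exists [set k] => //; rewrite setTI|exact: sigma_seq_bigcap].
by rewrite prob_max_lt Ngnb.
Qed.

End random_max.

(** * Normalization of a regularly varying tail *)

Section regular_variation.
Context {R : realType}.
Variables (F : R -> R) (alpha : R).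
Hypothesis F_nd : {homo F : x y / x <= y}.
Hypothesis F_le1 : forall x, F x <= 1.
Hypothesis F_y : F x @[x --> +oo] --> (1 : R).
Hypothesis F_Ny : F x @[x --> -oo] --> (0 : R).
Hypothesis F_lt1 : forall x, F x < 1.
Hypothesis F_tail : forall x : R, 0 < x ->
  (1 - F (x * y)) / (1 - F y) @[y --> +oo] --> x `^ (- alpha).
Local Notation b n := (ginv F (1 - n%:R^-1)).

(** As F tends to 0 at -oo, the set whose infimum defines [ginv F u] is bounded
below when 0 < u. *)
Lemma lt_ginv (u x : R) : 0 < u -> x < ginv F u -> F x < u.
Proof.
move=> u0; rewrite ltNge => xu; rewrite ltNge; apply: contra xu => uF.
apply: ge_inf => //.
have /cvgrPdist_lt/(_ u u0)[A [_ FA]] := F_Ny.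
exists (A - 1) => y /= uy; rewrite leNgt; apply/negP => yA.
have := FA y; rewrite sub0r normrN => /(_ (lt_trans yA _)) H.
have : `|F y| < u by apply: H; rewrite ltrBlDr ltrDl.
by apply/negP; rewrite -leNgt (le_trans uy)// ler_norm.
Qed.

(** As F tends to 1 at +oo, the set whose infimum defines [ginv F u] is
nonempty when u < 1. *)
Lemma ginv_lt (u x : R) : 0 < u -> u < 1 -> ginv F u < x -> u <= F x.
Proof.
move=> u0 u1 ux.
have /cvgrPdist_lt/(_ (1 - u))[|A [_ FA]] := F_y; first by rewrite subr_gt0.
have : [set x | u <= F x] !=set0.
  exists (A + 1) => /=; have := FA (A + 1).
  rewrite ltrDl => /(_ ltr01); rewrite ger0_norm ?subr_ge0// => h.
  by apply: ltW; move: h; lra.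
move=> ne; have [y /= uy yx] : exists2 y, u <= F y & y < x.
  exact: (inf_lt ne).
by rewrite (le_trans uy)// F_nd// ltW.
Qed.

Lemma ginv_cvgy : b n @[n --> \oo] --> +oo.
Proof.
apply/cvgryPge => A; near=> n.
have n1 : (1 < n)%N by near: n; exact: nbhs_infty_gt.
have n0 : 0 < n%:R :> R by rewrite ltr0n (ltn_trans _ n1).
have A1 : 0 < 1 - F A by rewrite subr_gt0.
have FAn : F A < 1 - n%:R^-1.
  rewrite ltrBrDr -ltrBrDl -[ltRHS]invrK ltf_pV2 ?posrE ?invr_gt0//.
  by near: n; exact: nbhs_infty_gtr.
rewrite leNgt; apply/negP => bA.
have := @ginv_lt (1 - n%:R^-1) A.
rewrite subr_gt0 invf_lt1 ?ltr1n// ltrBlDr ltrDl invr_gt0 => /(_ n1 n0 bA).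
by apply/negP; rewrite -ltNge.
Unshelve. all: by end_near. Qed.

(** With b n the quantile of order 1 - 1 / n, n (1 - F (x b n)) tends to
x ^ (- alpha). *)
Lemma tail_ginv (x : R) : 0 < x ->
  n%:R * (1 - F (x * b n)) @[n --> \oo] --> x `^ (- alpha).
Proof.
have ratio y : 0 < y -> (1 - F (y * b n)) / (1 - F (b n)) @[n --> \oo] --> y `^ (- alpha).
  by move=> y0; exact: (cvg_comp _ _ ginv_cvgy (F_tail y0)).
have tail0 y : 0 < 1 - F y by rewrite subr_gt0.
(* F only satisfies F((1 - t) b) < 1 - 1/n <= F((1 + t) b) around the quantile
   b = b n; dividing by 1 - F(b) and letting t be small gives
   1 / (n (1 - F(b))) --> 1. *)
have nb : n%:R * (1 - F (b n)) @[n --> \oo] --> (1 : R).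
  have inv : (n%:R * (1 - F (b n)))^-1 @[n --> \oo] --> (1 : R).
    apply/cvgrPdist_le => e e0.
    have pc : (fun y : R => y `^ (- alpha)) y @[y --> (1 : R)] --> (1 : R).
      have h1 : (1 : R) `^ (- alpha) = 1 by rewrite powR1.
      rewrite -[X in _ --> X]h1.
      change {for (1 : R), continuous (@powR R ^~ (- alpha))}.
      apply: differentiable_continuous; apply/derivable1_diffP.
      by apply: derivable_powR; rewrite in_itv/= ltr01.
    have e20 : 0 < e / 2 by rewrite divr_gt0.
    have /cvgrPdist_le/(_ _ e20)[dl /= dl0 Hd] := pc.
    pose t := Num.min (dl / 2) (1 / 2).
    have t0 : 0 < t by rewrite lt_min !divr_gt0.
    have tl : t < dl by rewrite gt_min; apply/orP; left; lra.
    have t1 : t < 1 by rewrite gt_min; apply/orP; right; lra.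
    have Hm : `|1 - (1 - t) `^ (- alpha)| <= e / 2.
      by apply: Hd; rewrite /= opprB addrC subrK gtr0_norm.
    have Hp : `|1 - (1 + t) `^ (- alpha)| <= e / 2.
      by apply: Hd; rewrite /= opprD addrA subrr sub0r normrN gtr0_norm.
    have tm : 0 < 1 - t by rewrite subr_gt0.
    have tp : 0 < 1 + t by rewrite addr_gt0.
    have /cvgrPdist_le/(_ _ e20) Rm := ratio _ tm.
    have /cvgrPdist_le/(_ _ e20) Rp := ratio _ tp.
    near=> n.
    have n1 : (1 < n)%N by near: n; exact: nbhs_infty_gt.
    have n0 : (0 : R) < n%:R by rewrite ltr0n (ltn_trans _ n1).
    have u0 : 0 < 1 - n%:R^-1 :> R by rewrite subr_gt0 invf_lt1 ?ltr1n.
    have u1 : 1 - n%:R^-1 < 1 :> R by rewrite ltrBlDr ltrDl invr_gt0.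
    have b0 : 0 < b n.
      by near: n; move/cvgryPgt : ginv_cvgy; apply.
    have l1 : n%:R^-1 <= 1 - F ((1 - t) * b n).
      have := @lt_ginv (1 - n%:R^-1) ((1 - t) * b n) u0.
      rewrite -[X in _ < X]mul1r ltr_pM2r// ltrBlDr ltrDl => /(_ t0); lra.
    have l2 : 1 - F ((1 + t) * b n) <= n%:R^-1.
      have := @ginv_lt (1 - n%:R^-1) ((1 + t) * b n) u0 u1.
      rewrite -[X in X < _]mul1r ltr_pM2r// ltrDl => /(_ t0); lra.
    rewrite invfM.
    have k1 : n%:R^-1 / (1 - F (b n)) <= (1 - F ((1 - t) * b n)) / (1 - F (b n)).
      by rewrite ler_pM2r ?invr_gt0.
    have k2 : (1 - F ((1 + t) * b n)) / (1 - F (b n)) <= n%:R^-1 / (1 - F (b n)).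
      by rewrite ler_pM2r ?invr_gt0.
    have k3 : `|(1 - t) `^ (- alpha) - (1 - F ((1 - t) * b n)) / (1 - F (b n))| <= e / 2.
      by near: n.
    have k4 : `|(1 + t) `^ (- alpha) - (1 - F ((1 + t) * b n)) / (1 - F (b n))| <= e / 2.
      by near: n.
    move: Hm Hp k1 k2 k3 k4; rewrite !ler_norml; lra.
  rewrite -[X in _ --> X]invr1; under eq_fun do rewrite -[_ * _]invrK.
  by apply: cvgV => //; rewrite oner_eq0.
move=> x0; rewrite -[X in _ --> X]mul1r.
rewrite (_ : (fun n : nat => _) = (fun n => n%:R * (1 - F (b n)) *
    ((1 - F (x * b n)) / (1 - F (b n))))); first exact: cvgM (ratio _ x0).
apply/funext => n; field.
by rewrite gt_eqF// tail0.
Unshelve. all: by end_near. Qed.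

End regular_variation.

(** * Distribution functions *)

Lemma eq_dist_ray (R : realType) d1 (T1 : measurableType d1) (P1 : probability T1 R)
    d2 (T2 : measurableType d2) (P2 : probability T2 R)
    (X : {RV P1 >-> R}) (Y : T2 -> R) : measurable_fun [set: T2] Y ->
  (forall x, P1 [set w | (X w < x)%R] = P2 [set w | (Y w < x)%R]) ->
  eq_dist P1 P2 X Y.
Proof.
move=> mY XY A mA.
pose Y_mixin := isMeasurableFun.Build _ _ _ _ _ mY.
pose Y' : {mfun T2 >-> R} := HB.pack Y Y_mixin.
exact: (@eq_probability_ray _ (distribution P1 X) (distribution P2 Y')).
Qed.

(** For negative [Q w] the power is not the one intended (it equals 1), which is
why [Q] is assumed almost surely nonnegative. *)
Lemma scaled_power_law d (T : measurableType d) (R : realType) (P : probability T R)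
    (Q : T -> R) (k p x : R) : measurable_fun [set: T] Q ->
  0 < k -> 0 < p -> P [set w | Q w < 0] = 0%E ->
  P [set w | (k * Q w `^ p < x)%R] =
  if 0 < x then P [set w | (Q w < (x / k) `^ p^-1)%R] else 0%E.
Proof.
move=> mQ k0 p0 Q0; case: ltP => x0; last first.
  rewrite (_ : [set w | _] = set0) ?measure0//; apply/seteqP; split => // w /=.
  by apply/negP; rewrite -leNgt (le_trans x0)// mulr_ge0 ?powR_ge0 ?ltW.
have mA : measurable [set w | k * Q w `^ p < x].
  apply: measurable_lt_ray; apply: measurable_funM => //.
  by apply: (measurableT_comp (@measurable_powR R p)).
rewrite -(@measureU0 _ _ _ P _ [set w | Q w < 0])//; last exact: measurable_lt_ray.
have y0 : 0 < (x / k) `^ p^-1 by rewrite powR_gt0 ?divr_gt0.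
congr (P _); apply/seteqP; split => w /=.
- move=> [|Qw]; last exact: lt_trans Qw y0.
  have [Qw _|Qw] := ltP (Q w) 0; first exact: lt_trans Qw y0.
  rewrite mulrC -ltr_pdivlMr// => Qx.
  rewrite -[ltLHS](powRr1 Qw) -(@mulfV _ p) ?gt_eqF// powRrM.
  by apply: gt0_ltr_powR; rewrite ?invr_gt0 ?nnegrE ?powR_ge0 ?divr_ge0 ?ltW.
- move=> Qy; have [Qw|Qw] := ltP (Q w) 0; [by right|left].
  rewrite mulrC -ltr_pdivlMr//.
  rewrite -[ltRHS](@powRr1 _ (x / k)) ?divr_ge0 ?ltW// -(@mulVf _ p) ?gt_eqF// powRrM.
  by apply: gt0_ltr_powR; rewrite ?nnegrE ?powR_ge0.
Qed.

Section dfun_theory.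
Context d (T : measurableType d) (R : realType) (P : probability T R).

Lemma dfun_nondecreasing (X : T -> R) : (forall x, measurable [set w | X w < x]) ->
  {homo dfun P X : x y / x <= y}.
Proof.
move=> mX x y xy; rewrite /dfun fine_le ?fin_num_measure// le_measure ?inE//.
by move=> w /= /lt_le_trans; apply.
Qed.

Lemma dfun_itv (X : T -> R) x : measurable [set w | X w < x] -> 0 <= dfun P X x <= 1.
Proof.
move=> mX; rewrite /dfun fine_ge0//= -[leRHS]/(fine 1%E).
by rewrite fine_le ?fin_num_measure// probability_le1.
Qed.

Variable X : {RV P >-> R}.

(** The distribution functions P(X < x) and P(X <= x) squeeze each other, which
transfers the limits at infinity from the latter to the former. *)
Lemma dfun_le_cdf x : dfun P X x <= fine (cdf X x).
Proof.
rewrite /dfun fine_le ?fin_num_measure//; first exact: measurable_rv_ray.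
rewrite /cdf /distribution /pushforward le_measure ?inE//.
- exact: measurable_rv_ray.
- by rewrite -[X in measurable X]setTI; exact: (@measurable_funPT _ _ _ _ X).
- by move=> w /=; rewrite in_itv/= => /ltW.
Qed.

Lemma cdf_le_dfun x y : x < y -> fine (cdf X x) <= dfun P X y.
Proof.
move=> xy; rewrite /dfun fine_le ?fin_num_measure//; first exact: measurable_rv_ray.
rewrite /cdf /distribution /pushforward le_measure ?inE//.
- by rewrite -[X in measurable X]setTI; exact: (@measurable_funPT _ _ _ _ X).
- exact: measurable_rv_ray.
- by move=> w /=; rewrite in_itv/= => /le_lt_trans; apply.
Qed.

Lemma dfun_cvgy : dfun P X x @[x --> +oo] --> (1 : R).
Proof.
have cy : fine (cdf X x) @[x --> +oo] --> (1 : R) by apply: fine_cvg; exact: cvg_cdfy1.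
apply/cvgrPdist_le => e e0; near=> x.
have /andP[_ le1] := dfun_itv (measurable_rv_ray X x).
rewrite ger0_norm ?subr_ge0// (le_trans _ (_ : 1 - fine (cdf X (x - 1)) <= e))//.
  by rewrite lerD2l lerN2 cdf_le_dfun// ltrBlDr ltrDl.
rewrite (le_trans (ler_norm _))//; near: x.
have /cvgrPdist_le/(_ _ e0)[A [rA HA]] := cy.
exists (A + 1); split; first by rewrite num_real.
by move=> x /=; rewrite -ltrBrDr => /HA.
Unshelve. all: by end_near. Qed.

Lemma dfun_cvgNy : dfun P X x @[x --> -oo] --> (0 : R).
Proof.
have cy : fine (cdf X x) @[x --> -oo] --> (0 : R) by apply: fine_cvg; exact: cvg_cdfNy0.
apply: (squeeze_cvgr _ (cvg_cst 0) cy); apply: nearW => x.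
by rewrite dfun_le_cdf andbT; have /andP[] := dfun_itv (measurable_rv_ray X x).
Qed.

(** An infinite right extremity means that F never reaches 1. *)
Lemma dfun_lt1 : rext (dfun P X) = +oo%E -> forall x, dfun P X x < 1.
Proof.
move=> r x; rewrite ltNge; apply/negP => x1.
suff : (rext (dfun P X) <= x%:E)%E by rewrite r leye_eq.
apply: ge_ereal_sup => _ [y /= y1 <-]; rewrite lee_fin leNgt; apply/negP => xy.
have := dfun_nondecreasing (measurable_rv_ray X) (ltW xy).
by apply/negP; rewrite -ltNge (lt_le_trans y1).
Qed.

End dfun_theory.

(** * Extremes of samples of random size *)

Theorem theorem1 (R : realType) (r gam lam alpha : R)
  (r0 : 0 < r) (gam0 : 0 < gam) (lam0 : 0 < lam) (alpha0 : 0 < alpha)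
  (d : measure_display) (T : measurableType d) (P : probability T R)
  (X : nat -> {RV P >-> R}) (N : nat -> {RV P >-> nat}) (F : R -> R)
  (X_indep : mutual_indep P (fun i => sigma_rv (X i)))
  (X_df : forall i x, dfun P (X i) x = F x)
  (N_gnb : forall n, (0 < n)%N ->
     is_gnb P (N n) r gam (lam / n%:R `^ gam))
  (N_indep : forall n, (0 < n)%N ->
     indep2 P (sigma_rv (N n)) (sigma_seq (fun i w => X i w)))
  (F_rext : rext F = +oo%E)
  (F_tail : forall x : R, 0 < x ->
     (1 - F (x * y)) / (1 - F y) @[y --> +oo] --> x `^ (- alpha))
  (dM : measure_display) (TM : measurableType dM) (PM : probability TM R)
  (M : {RV PM >-> R})
  (d1 : measure_display) (T1 : measurableType d1) (P1 : probability T1 R)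
  (G1 W1 : {RV P1 >-> R})
  (G1_law : is_ggamma P1 G1 r (alpha * gam) lam)
  (W1_law : is_weibull P1 W1 alpha)
  (GW1_indep : indep_rv P1 G1 W1)
  (M_law : eq_dist PM P1 M (fun w => G1 w / W1 w)) :
  [/\ (sup [set `| dfun P (fun w => max_first (fun i => X i w) (N n w) /
                                    ginv F (1 - n%:R^-1)) x
                   - dfun PM M x | | x in [set x : R | 0 <= x]]
         @[n --> \oo] --> (0 : R)),
      (forall (d2 : measure_display) (T2 : measurableType d2)
          (P2 : probability T2 R) (G2 W2 : {RV P2 >-> R}),
        is_ggamma P2 G2 r gam lam -> is_weibull P2 W2 1 ->
        indep_rv P2 G2 W2 ->
        eq_dist PM P2 M (fun w => (G2 w / W2 w) `^ alpha^-1)) &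
      (forall (d3 : measure_display) (T3 : measurableType d3)
          (P3 : probability T3 R) (G3 W3 : {RV P3 >-> R}),
        is_gamma P3 G3 r 1 -> is_weibull P3 W3 gam^-1 ->
        indep_rv P3 G3 W3 ->
        eq_dist PM P3 M
          (fun w => lam `^ (- (alpha * gam)^-1) *
                    (G3 w / W3 w) `^ (alpha * gam)^-1))].
Proof.
have ag0 : 0 < alpha * gam by rewrite mulr_gt0.
pose L := ggamma_laplace r gam lam.
have mass : (\int[lebesgue_measure]_(u in `]0%R, +oo[) (ggamma_pdf r gam lam u)%:E = 1)%E.
  have := @ggamma_mass R r (alpha * gam) lam 1 alpha^-1 ag0 lam0 ltr01.
  rewrite invr_gt0 => /(_ alpha0 (ggamma_law_mass G1_law)).
  by rewrite powR1 mulr1 mulrAC mulfV ?mul1r// gt_eqF.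
have M_ray x : PM [set w | (M w < x)%R] = P1 [set w | (G1 w / W1 w < x)%R].
  have := M_law `]-oo, x[%classic (measurable_itv _).
  by congr (PM _ = P1 _); apply/seteqP; split => w /=; rewrite in_itv.
have M_le0 x : x <= 0 -> PM [set w | (M w < x)%R] = 0%E.
  by move=> x0; rewrite M_ray; exact: (ratio_law_le0 G1_law W1_law GW1_indep).
have M_gt0 x : 0 < x -> PM [set w | (M w < x)%R] = (L ((1 / x) `^ alpha))%:E.
  move=> x0; rewrite M_ray (ratio_law ag0 lam0 alpha0 G1_law W1_law GW1_indep ltr01 x0).
  by rewrite powR1 mulr1 mulrAC mulfV ?mul1r// gt_eqF.
split; first last.
- move=> d3 T3 P3 G3 W3 G3_law W3_law GW3.
  have k0 : 0 < lam `^ (- (alpha * gam)^-1) by rewrite powR_gt0.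
  have p0 : 0 < (alpha * gam)^-1 by rewrite invr_gt0.
  have mQ : measurable_fun [set: T3] (fun w => G3 w / W3 w) by exact: measurable_fun_div.
  have gV0 : 0 < gam^-1 by rewrite invr_gt0.
  apply: eq_dist_ray.
    by apply: measurable_funM => //; apply: (measurableT_comp (@measurable_powR R _)).
  move=> x; rewrite scaled_power_law//; last first.
    exact: (ratio_law_le0 G3_law W3_law GW3).
  case: ltP => x0; last exact: M_le0.
  rewrite M_gt0// invrK; set y := (x / _) `^ _.
  have y0 : 0 < y by rewrite powR_gt0 ?divr_gt0.
  rewrite [RHS](ratio_law ltr01 ltr01 gV0 G3_law W3_law GW3 lam0 y0).
  (* The ratio law is used with a = 1 / gam and c = lam. *)
  have e1 : 1 / gam^-1 = gam by rewrite div1r invrK.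
  have e2 : 1 * lam `^ 1 = lam by rewrite mul1r powRr1 ?ltW.
  suff e3 : (lam / y) `^ gam^-1 = (1 / x) `^ alpha by rewrite e1 e2 e3.
  have -> : y = x `^ (alpha * gam) * lam.
    rewrite /y powRN invrK powRM ?powR_ge0 ?(ltW x0)// -powRrM mulVf ?gt_eqF//.
    by rewrite powRr1// ltW.
  rewrite invfM mulrCA mulfV ?gt_eqF// mulr1 div1r -powRN -powRrM.
  rewrite mulNr -mulrA mulfV ?gt_eqF// mulr1.
  by rewrite -(powR_inv1 (ltW x0)) -powRrM mulN1r.
- move=> d2 T2 P2 G2 W2 G2_law W2_law GW2.
  have p0 : 0 < alpha^-1 by rewrite invr_gt0.
  have mQ : measurable_fun [set: T2] (fun w => G2 w / W2 w) by exact: measurable_fun_div.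
  apply: eq_dist_ray; first by apply: (measurableT_comp (@measurable_powR R _)).
  move=> x.
  have := @scaled_power_law _ _ _ P2 _ 1 alpha^-1 x mQ ltr01 p0
    (ratio_law_le0 G2_law W2_law GW2 (lexx 0)).
  rewrite (_ : [set w | 1 * _ < x] = [set w | (G2 w / W2 w) `^ alpha^-1 < x]); last first.
    by apply/seteqP; split => w /=; rewrite mul1r.
  move=> ->; case: ltP => x0; last exact: M_le0.
  rewrite M_gt0// invrK divr1.
  have y0 : 0 < x `^ alpha by rewrite powR_gt0.
  rewrite [RHS](ratio_law gam0 lam0 ltr01 G2_law W2_law GW2 ltr01 y0).
  have e1 : gam / 1 = gam by rewrite divr1.
  have e2 : lam * 1 `^ gam = lam by rewrite powR1 mulr1.
  suff e3 : (1 / x `^ alpha) `^ 1 = (1 / x) `^ alpha by rewrite e1 e2 e3.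
  rewrite powRr1 ?divr_ge0 ?powR_ge0// !div1r.
  by rewrite -(powR_inv1 (ltW x0)) -powRrM mulN1r powRN.
have FE : dfun P (X 0%N) = F by apply/funext => x; exact: X_df.
have F_nd : {homo F : x y / x <= y}.
  by rewrite -FE; apply: dfun_nondecreasing; exact: measurable_rv_ray.
have F_le1 x : F x <= 1.
  by rewrite -FE; have /andP[] := dfun_itv P (measurable_rv_ray (X 0%N) x).
have F_y : F x @[x --> +oo] --> (1 : R) by rewrite -FE; exact: dfun_cvgy.
have F_Ny : F x @[x --> -oo] --> (0 : R) by rewrite -FE; exact: dfun_cvgNy.
have F_lt1 x : F x < 1 by move: F_rext; rewrite -FE => /dfun_lt1; apply.
pose b n := ginv F (1 - n%:R^-1).
have mE n x : measurable [set w | max_first (fun i => X i w) (N n w) / b n < x].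
  exact: measurable_max_event.
apply: polya.
- by move=> n x y _; apply: dfun_nondecreasing.
- by move=> n x; exact: dfun_itv.
- by move=> x y _; apply: dfun_nondecreasing; exact: measurable_rv_ray.
- by move=> x; apply: dfun_itv; exact: measurable_rv_ray.
move=> v v01; have [s s0 Ls] := ggamma_laplace_surj mass v01.
(* The point where the limit law has level v: x ^ (- alpha) = s. *)
pose x := (s `^ alpha^-1)^-1.
have x0 : 0 < x by rewrite invr_gt0 powR_gt0.
have xs : (1 / x) `^ alpha = s.
  by rewrite div1r invrK -powRrM mulVf ?gt_eqF// powRr1// ltW.
have Hx : dfun PM M x = L s by rewrite /dfun M_gt0// xs.
exists x; split; [exact: ltW|by rewrite Hx|rewrite Hx].
have tail : n%:R * (1 - F (x * b n)) @[n --> \oo] --> s.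
  have -> : s = x `^ (- alpha).
    by rewrite -xs div1r -(powR_inv1 (ltW x0)) -powRrM mulN1r.
  exact: tail_ginv.
have tail0 n : 0 <= n%:R * (1 - F (x * b n)) by rewrite mulr_ge0// subr_ge0.
apply: (cvg_trans _ (ggamma_laplace_cvg mass tail0 tail)).
apply: near_eq_cvg; near=> n.
have n0 : (0 < n)%N by near: n; exact: nbhs_infty_gt.
have nR : 0 < n%:R :> R by rewrite ltr0n.
have b0 : 0 < b n by near: n; move/cvgryPgt : (ginv_cvgy F_nd F_le1 F_y F_lt1); apply.
have ng : 0 < n%:R `^ gam :> R by rewrite powR_gt0.
(* The substitution z = n u turns the mixing density of parameter lam / n ^ gam
   into the one of parameter lam, and q z into (n q) u. *)
pose q := 1 - F (x * b n).
pose h (z : R) := expR (- (q * z)).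
have ch : {in `]0, +oo[, continuous h}.
  move=> z _.
  apply: (continuous_comp (f := fun z : R => - (q * z)) (g := expR));
    last exact: continuous_expR.
  by apply: continuousN; apply: continuousM => //; exact: cst_continuous.
have h0 z : 0 < z -> 0 <= h z by move=> _; exact: expR_ge0.
have E := ggamma_substitution r gam0 (divr_gt0 lam0 ng) nR ltr01 ch h0.
rewrite mulr1 divfK ?gt_eqF// in E.
rewrite /dfun (prob_random_max X_indep X_df (N_indep _ n0) b0 x0 (N_gnb _ n0)).
rewrite -[X in fine X]/(\int[lebesgue_measure]_(u in `]0%R, +oo[)
  (h u * ggamma_pdf r gam (lam / n%:R `^ gam) u)%:E)%E E.
congr (fine _); apply: eq_integral => u /[!inE]/= /[!in_itv]/= /[!andbT] u0.
by rewrite /h /q powRr1 ?(ltW u0)// mulrA (mulrC (1 - _)).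
Unshelve. all: by end_near. Qed.
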